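(* The category of locales, defined to be the opposite category of the category of frames, is rigid: every endo-equivalence on it is naturally isomorphic to the identity functor.
   Context: A frame is a complete lattice satisfying $a\wedge\bigvee_{i\in I}b_i=\bigvee_{i\in I}(a\wedge b_i)$. The arrows of the category of frames are the functions preserving finite meets (including the top element $1$) and arbitrary joins (including the bottom element $0$). An endo-equivalence on a category $\mathcal{C}$ is a functor $\mathbb{T}:\mathcal{C}\to\mathcal{C}$ which is full and faithful and has a full and faithful left adjoint (i.e. an equivalence of categories from $\mathcal{C}$ to itself). A category is called rigid if every endo-equivalence on it is (naturally) isomorphic to the identity functor. *)

(* Defs.v *)
From HB Require Import structures.
From mathcomp Require Import all_boot all_order.
From mathcomp Require Import boolp classical_sets.

Set Implicit Arguments.
Unset Strict Implicit.
Unset Printing Implicit Defensive.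

Import Order.Theory.
Local Open Scope classical_set_scope.
Local Open Scope order_scope.

(** * Categories *)

(* Equality of arrows is Leibniz equality. *)
Record category := Category {
  obj :> Type;
  hom : obj -> obj -> Type;
  idm : forall a, hom a a;
  comph : forall a b c, hom b c -> hom a b -> hom a c;
  comp_idl : forall a b (f : hom a b), comph (idm b) f = f;
  comp_idr : forall a b (f : hom a b), comph f (idm a) = f;
  comp_assoc : forall a b c d (h : hom c d) (g : hom b c) (f : hom a b),
    comph h (comph g f) = comph (comph h g) f }.

Arguments hom {c} a b : rename.
Arguments idm {c} a : rename.
Arguments comph {c a b c'} g f : rename.

Notation "g \oc f" := (comph g f) (at level 50, left associativity).

Definition opposite (C : category) : category :=
  @Category C (fun a b => @hom C b a) (fun a => idm a)
    (fun a b c g f => f \oc g)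
    (fun a b f => comp_idr f) (fun a b f => comp_idl f)
    (fun a b c d h g f => esym (comp_assoc f g h)).

Record functor (C D : category) := Functor {
  fobj :> C -> D;
  fmap : forall a b : C, hom a b -> hom (fobj a) (fobj b);
  fmap_id : forall a : C, fmap (idm a) = idm (fobj a);
  fmap_comp : forall (a b c : C) (g : hom b c) (f : hom a b),
    fmap (g \oc f) = fmap g \oc fmap f }.

Arguments fmap {C D} F {a b} f : rename.

Definition id_functor (C : category) : functor C C :=
  @Functor C C id (fun a b f => f) (fun a => erefl) (fun a b c g f => erefl).

Definition full (C D : category) (F : functor C D) : Prop :=
  forall (a b : C) (g : hom (F a) (F b)), exists f : hom a b, fmap F f = g.

Definition faithful (C D : category) (F : functor C D) : Prop :=
  forall a b : C, injective (@fmap C D F a b).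

Definition natural (C D : category) (F G : functor C D)
    (t : forall a : C, hom (F a) (G a)) : Prop :=
  forall (a b : C) (f : hom a b), t b \oc fmap F f = fmap G f \oc t a.

Definition is_iso (C : category) (a b : C) (f : hom a b) : Prop :=
  exists g : hom b a, g \oc f = idm a /\ f \oc g = idm b.

Definition naturally_isomorphic (C D : category) (F G : functor C D) : Prop :=
  exists t : forall a : C, hom (F a) (G a),
    natural t /\ forall a : C, is_iso (t a).

(* L is left adjoint to R: bijections hom (L a) b -> hom a (R b), natural in
   both a and b. *)
Definition left_adjoint (C D : category) (L : functor C D) (R : functor D C)
    : Prop :=
  exists phi : forall (a : C) (b : D), hom (L a) b -> hom a (R b),
    (forall a b, bijective (@phi a b)) /\
    (forall (a a' : C) (b b' : D) (f : hom a' a) (g : hom b b')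
        (h : hom (L a) b),
      phi a' b' (g \oc h \oc fmap L f) = fmap R g \oc phi a b h \oc f).

Definition endo_equivalence (C : category) (T : functor C C) : Prop :=
  [/\ full T, faithful T &
      exists L : functor C C, [/\ left_adjoint L T, full L & faithful L]].

Definition rigid (C : category) : Prop :=
  forall T : functor C C,
    endo_equivalence T -> naturally_isomorphic T (id_functor C).

(** * Frames *)

(* Existence of the join of every subset makes the lattice complete; the join
   of a family is the join of its range, so subsets suffice. *)
HB.mixin Record TBLattice_isFrame d T of Order.TBLattice d T := {
  bigjoin : set T -> T;
  bigjoinP : forall B : set T, isLub B (bigjoin B);
  meet_bigjoin : forall (a : T) (B : set T),
    a `&` bigjoin B = bigjoin [set a `&` b | b in B]
}.

#[short(type="frameType")]
HB.structure Definition Frame d :=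
  {T of TBLattice_isFrame d T & Order.TBLattice d T}.

(* The finite meets are generated by \top and binary meets; the bottom is
   bigjoin set0. *)
Record frame_hom (d d' : Order.disp_t) (A : frameType d) (B : frameType d') :=
  FrameHom {
    frame_fun :> A -> B;
    frame_hom_top : frame_fun \top = \top;
    frame_hom_meet : {morph frame_fun : x y / x `&` y};
    frame_hom_join : forall S : set A,
      frame_fun (bigjoin S) = bigjoin [set frame_fun x | x in S] }.

Lemma frame_hom_eq (d d' : Order.disp_t) (A : frameType d) (B : frameType d')
    (f g : frame_hom A B) : f =1 g -> f = g.
Proof.
case: f g => [f f1 f2 f3] [g g1 g2 g3] /= /funext efg.
by subst g; congr FrameHom; exact: Prop_irrelevance.
Qed.

Definition frame_id (d : Order.disp_t) (A : frameType d) : frame_hom A A.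
Proof. by exists id => // S; rewrite image_id. Defined.

Definition frame_comp (d d' d'' : Order.disp_t) (A : frameType d)
    (B : frameType d') (C : frameType d'') (g : frame_hom B C)
    (f : frame_hom A B) : frame_hom A C.
Proof.
exists (g \o f) => [|x y|S] /=.
- by rewrite !frame_hom_top.
- by rewrite !frame_hom_meet.
- by rewrite !frame_hom_join image_comp.
Defined.

(* The display d is only a notational tag; it carries no mathematical
   content. *)
Definition Frm (d : Order.disp_t) : category.
Proof.
exists (frameType d) (@frame_hom d d) (@frame_id d) (@frame_comp d d d).
- by move=> A B f; exact: frame_hom_eq.
- by move=> A B f; exact: frame_hom_eq.
- by move=> A B C D h g f; exact: frame_hom_eq.
Defined.

Definition Loc (d : Order.disp_t) : category := opposite (Frm d).

(* Main.v *)
Require Import Defs.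
From mathcomp Require Import all_boot all_order.
From HB Require Import structures.
From mathcomp Require Import boolp classical_sets.

(** An endo-equivalence of locales is an endo-equivalence F of frames with the
    arrows reversed.  The three-element chain S, with middle element mid, is
    the free frame on one generator: the elements x of a frame A correspond to
    the homomorphisms [classify x] from S to A that send mid to x.

    F fixes S up to isomorphism ([sierpinski_fixed]).  Indeed S is a separator,
    F is full and S is isomorphic to a value of F, so some homomorphism
    h : F S -> S tells apart the two endomorphisms of S that send mid to \bot
    and to \top; it therefore sends some element a of F S to mid
    ([exists_over_mid]).  The composites F S -> S -> S -> F S of h, an
    endomorphism of S and [classify a] are three distinct endomorphisms of F S.
    Since F S has no more endomorphisms than S, which has three, the identity
    of F S is one of them, and this forces h and [classify a] to be inverse.

    Hence x |-> F (classify x) a is a bijection from A to F A, natural in A,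
    called [transport] below.  It remains to see that it respects the order,
    for an order isomorphism of frames is an isomorphism of frames.

    - The pairs x <= y in A are the images of the middle pair lo <= hi of a
      four-element chain.  The meet of the transports of lo and hi is the
      transport of an element of this chain; collapsing lo and hi to mid shows
      that this element is lo or hi.  In the first case all the transports are
      monotone, in the second they are all antitone
      ([transport_mono_or_anti]).
    - If they were antitone, then F A would be the opposite lattice of A, and
      every frame homomorphism would preserve infinite meets.  But the homomorphism
      from the chain \bot < ... < 2 < 1 < 0 to S that sends only \bot to \bot
      does not ([transport_mono]).
    - A monotone transport is an isomorphism on the four-element chain.  So an
      inequality between transports in F A is classified by a homomorphism in
      the image of F, and comes from an inequality in A
      ([transport_reflects]). *)

Set Implicit Arguments.
Unset Strict Implicit.
Unset Printing Implicit Defensive.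

Import Order.Theory.
Local Open Scope classical_set_scope.
Local Open Scope order_scope.

(** * Frame homomorphisms and order *)

Section FrameFacts.
Variables d d' : Order.disp_t.

Lemma bigjoin_unique (A : frameType d) (B : set A) (m : A) :
  isLub B m -> bigjoin B = m.
Proof.
case: (bigjoinP B) => ubB leB [ubm lem].
by apply/le_anti/andP; split; [exact: leB | exact: lem].
Qed.

Lemma bigjoin_set0 (A : frameType d) : bigjoin (@set0 A) = \bot.
Proof. by apply: bigjoin_unique; split => // b _; exact: le0x. Qed.

Lemma bigjoin_max (A : frameType d) (B : set A) (m : A) :
  B m -> ubound B m -> bigjoin B = m.
Proof. by move=> Bm ubm; apply: bigjoin_unique; split => // b; exact. Qed.

Variables (A : frameType d) (B : frameType d').

Lemma frame_hom_mono (f : frame_hom A B) : {homo f : x y / x <= y}.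
Proof. by move=> x y /meet_idPl <-; rewrite frame_hom_meet leIr. Qed.

Lemma frame_hom_bot (f : frame_hom A B) : f \bot = \bot.
Proof.
rewrite -bigjoin_set0 frame_hom_join image_set0.
by apply: le_anti; rewrite le0x andbT; apply: (bigjoinP _).2 => x [].
Qed.

End FrameFacts.

Section OrderIsomorphism.
Variables (d d' : Order.disp_t) (A : frameType d) (B : frameType d').
Variables (f : A -> B) (g : B -> A).
Hypothesis gK : cancel g f.
Hypothesis f_le : {mono f : x y / x <= y}.

Let iso_top : f \top = \top.
Proof. by apply: le_anti; rewrite lex1 -[\top]gK f_le lex1. Qed.

Let iso_meet : {morph f : x y / x `&` y}.
Proof.
move=> x y; apply: le_anti; rewrite lexI !f_le leIl leIr /=.
by rewrite -[X in X <= _]gK f_le lexI -!f_le gK leIl leIr.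
Qed.

Let iso_join (S : set A) : f (bigjoin S) = bigjoin [set f x | x in S].
Proof.
symmetry; apply: bigjoin_unique; split.
  by move=> _ [x Sx <-]; rewrite f_le; apply: (bigjoinP S).1.
move=> b ubb; rewrite -[b]gK f_le; apply: (bigjoinP S).2 => x Sx.
by rewrite -f_le gK; apply: ubb; exists x.
Qed.

Definition order_iso_hom : frame_hom A B := FrameHom iso_top iso_meet iso_join.

End OrderIsomorphism.

(** * Chains in which every nonempty subset has a greatest element *)

(** In such a chain a nonempty join is attained, so a monotone map that
    preserves \bot and \top is already a frame homomorphism: this makes it easy
    to write homomorphisms out of the chains used below. *)
Definition has_maxima d (K : frameType d) :=
  forall B : set K, B !=set0 -> exists2 m, B m & ubound B m.

Section HomFromChain.
Variables (d d' : Order.disp_t) (K : frameType d) (A : frameType d') (f : K -> A).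
Hypotheses (Kmax : has_maxima K) (f_mono : {homo f : x y / x <= y}).
Hypotheses (f_bot : f \bot = \bot) (f_top : f \top = \top).

Let hom_meet : {morph f : x y / x `&` y}.
Proof.
move=> x y; have [|m xym ubm] := Kmax (B := [set x; y]); first by exists x; left.
case: xym ubm => -> ubm.
  have yx : y <= x by apply: ubm; right.
  by rewrite (meet_idPr yx) (meet_idPr (f_mono yx)).
have xy : x <= y by apply: ubm; left.
by rewrite (meet_idPl xy) (meet_idPl (f_mono xy)).
Qed.

Let hom_join (S : set K) : f (bigjoin S) = bigjoin [set f x | x in S].
Proof.
have [->|/set0P/Kmax[m Sm ubm]] := eqVneq S set0.
  by rewrite image_set0 !bigjoin_set0.
rewrite (bigjoin_max Sm ubm); symmetry; apply: bigjoin_max; first by exists m.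
by move=> _ [x Sx <-]; apply: f_mono; exact: ubm.
Qed.

Definition chain_frame_hom : frame_hom K A := FrameHom f_top hom_meet hom_join.

End HomFromChain.

(** An index set for the non-bottom elements of a chain.  Deeper
    elements are smaller, so a nonempty set of elements has a greatest one
    because a nonempty set of natural numbers has a least one. *)
Record levels := Levels {
  level :> choiceType;
  depth : level -> nat;
  depth_inj : injective depth;
  surface : level;
  depth_surface : depth surface = 0 }.

Definition descending (d : Order.disp_t) (U : levels) : Type := option U.

Section Descending.
Variables (d : Order.disp_t) (U : levels).
Local Notation chain := (descending d U).

HB.instance Definition _ := Choice.on chain.

Definition descending_le (x y : chain) : bool :=
  match x, y with
  | None, _ => true
  | Some _, None => false
  | Some u, Some v => (depth v <= depth u)%N
  end.

Fact descending_le_refl : reflexive descending_le.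
Proof. by case=> [u|] //=. Qed.

Fact descending_le_anti : antisymmetric descending_le.
Proof.
move=> [u|] [v|] //= uv; congr Some; apply: depth_inj; apply: anti_leq.
by rewrite andbC.
Qed.

Fact descending_le_trans : transitive descending_le.
Proof. by move=> [v|] [u|] [w|] //= uv vw; exact: leq_trans vw uv. Qed.

Fact descending_le_total : total descending_le.
Proof. by move=> [u|] [v|] //=; exact: leq_total. Qed.

HB.instance Definition _ := Order.Le_isPOrder.Build d chain
  descending_le_refl descending_le_anti descending_le_trans.

HB.instance Definition _ := Order.POrder_isTotal.Build d chain
  descending_le_total.

HB.instance Definition _ := Order.hasBottom.Build d chain
  (bottom := None : chain) (fun x => isT).

Fact descending_lex1 (x : chain) : x <= (Some (surface U) : chain).
Proof. by case: x => [u|] //=; rewrite /Order.le /= depth_surface. Qed.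

HB.instance Definition _ := Order.hasTop.Build d chain descending_lex1.

Lemma descending_max (B : set chain) :
  B !=set0 -> exists2 m, B m & ubound B m.
Proof.
move=> [x Bx]; have [[u Bu]|nB] := pselect (exists u : U, B (Some u)); last first.
  have BN y : B y -> y = None by case: y => // u Bu; case: nB; exists u.
  by exists x => // y /BN ->.
have [n [v [Bv <-]] nmin] : exists2 n, (exists v : U, B (Some v) /\ depth v = n) &
    forall v : U, B (Some v) -> (n <= depth v)%N.
  have ex : exists n, `[< exists v : U, B (Some v) /\ depth v = n >].
    by exists (depth u); apply/asboolP; exists u.
  case: (ex_minnP ex) => n /asboolP nB nmin; exists n => // v Bv.
  by apply: nmin; apply/asboolP; exists v.
by exists (Some v) => // -[w|] Bw; [exact: nmin | exact: le0x].
Qed.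

Definition descending_join (B : set chain) : chain :=
  xget None [set m | B m /\ ubound B m].

Fact descending_joinP (B : set chain) : isLub B (descending_join B).
Proof.
rewrite /descending_join; case: xgetP => [m _ [Bm ubm]|noB].
  by split=> // b; exact.
have B0 x : ~ B x.
  move=> Bx; have [|m Bm ubm] := @descending_max B; first by exists x.
  exact: (noB m).
by split => [x /B0|b _] //; exact: le0x.
Qed.

Fact descending_meet_join (a : chain) (B : set chain) :
  a `&` descending_join B = descending_join [set a `&` b | b in B].
Proof.
have [ub le] := descending_joinP [set a `&` b | b in B].
have [ubB leB] := descending_joinP B.
apply: le_anti; apply/andP; split; last first.
  by apply: le => _ [b Bb <-]; apply: leI2 => //; exact: ubB.
have [[b Bb ab]|nB] := pselect (exists2 b, B b & a <= b).
  rewrite leIx2 //; apply/orP; left.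
  by rewrite -[X in X <= _](meet_idPl ab); apply: ub; exists b.
rewrite leIx2 //; apply/orP; right; apply: leB => b Bb.
have /ltW ba : b < a by rewrite ltNge; apply/negP => ab; apply: nB; exists b.
by rewrite -[X in X <= _](meet_idPr ba); apply: ub; exists b.
Qed.

HB.instance Definition _ := TBLattice_isFrame.Build d chain
  descending_joinP descending_meet_join.

Section Hom.
Variables (d' : Order.disp_t) (A : frameType d') (x : U -> A).
Hypothesis x_mono : forall u v, (depth v <= depth u)%N -> x u <= x v.
Hypothesis x_top : x (surface U) = \top.

Definition descending_fun (o : chain) : A := if o is Some u then x u else \bot.

Fact descending_fun_mono : {homo descending_fun : y z / y <= z}.
Proof. by move=> [u|] [v|] //= uv; [exact: x_mono | exact: le0x..]. Qed.

Definition descending_hom : frame_hom chain A :=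
  @chain_frame_hom _ _ chain A descending_fun descending_max
     descending_fun_mono erefl x_top.

End Hom.
End Descending.

(** * The free frame on a generator and the free frame on a comparable pair *)

Definition finite_levels (n : nat) : levels :=
  @Levels 'I_n.+1 val val_inj ord0 erefl.

Definition nat_levels : levels := @Levels nat id (@inj_id nat) 0 erefl.

Definition sierpinski (d : Order.disp_t) : frameType d :=
  descending d (finite_levels 1).

Definition chain4 (d : Order.disp_t) : frameType d :=
  descending d (finite_levels 2).

Definition omega_chain (d : Order.disp_t) : frameType d := descending d nat_levels.

Definition mid (d : Order.disp_t) : sierpinski d := Some (@Ordinal 2 1 isT).
Definition hi (d : Order.disp_t) : chain4 d := Some (@Ordinal 3 1 isT).
Definition lo (d : Order.disp_t) : chain4 d := Some (@Ordinal 3 2 isT).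

Lemma sierpinskiE d (s : sierpinski d) : [\/ s = \bot, s = mid d | s = \top].
Proof.
case: s => [[[|[|//]] i]|]; last by apply: Or31.
  by apply: Or33; congr Some; apply: val_inj.
by apply: Or32; congr Some; apply: val_inj.
Qed.

Lemma chain4E d (s : chain4 d) : [\/ s = \bot, s = lo d, s = hi d | s = \top].
Proof.
case: s => [[[|[|[|//]]] i]|]; last by apply: Or41.
- by apply: Or44; congr Some; apply: val_inj.
- by apply: Or43; congr Some; apply: val_inj.
- by apply: Or42; congr Some; apply: val_inj.
Qed.

(** Endomorphisms of this chain correspond to its elements, so this lets one
    count endomorphisms. *)
Lemma sierpinski_inj_surj d (k : sierpinski d -> sierpinski d) :
  injective k -> forall s, exists s', k s' = s.
Proof.
move=> k_inj s; have /codomP[s' ->] := injF_onto (k_inj : @injective (option 'I_2) _ k) s.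
by exists s'.
Qed.

Section Classify.
Variables (d d' : Order.disp_t) (A : frameType d').

Definition classify (a : A) : frame_hom (sierpinski d) A.
Proof.
apply: (@descending_hom d (finite_levels 1) d' A
          (fun u : 'I_2 => if u == ord0 then \top else a)) => //.
by move=> [[|[|//]] i] [[|[|//]] j] //= _; exact: lex1.
Defined.

Lemma classify_unique (f g : frame_hom (sierpinski d) A) :
  f (mid d) = g (mid d) -> f = g.
Proof.
move=> fg; apply: frame_hom_eq => s; have [->|->|->] := sierpinskiE s => //.
  by rewrite !frame_hom_bot.
by rewrite !frame_hom_top.
Qed.

(** The four-element chain is the free frame on two generators [lo <= hi]. *)
Lemma chain4_hom (a b : A) :
  a <= b -> exists c : frame_hom (chain4 d) A, c (lo d) = a /\ c (hi d) = b.
Proof.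
move=> ab; pose x (u : 'I_3) := nth \bot [:: \top; b; a] u.
have x_mono (u v : 'I_3) : (v <= u)%N -> x u <= x v.
  by case: u v => [[|[|[|//]]] i] [[|[|[|//]]] j] //= _; exact: lex1.
by exists (@descending_hom d (finite_levels 2) d' A x x_mono erefl).
Qed.

End Classify.

Lemma classify_natural d d' d'' (A : frameType d') (B : frameType d'')
    (f : frame_hom A B) (a : A) :
  frame_comp f (classify d a) = classify d (f a).
Proof. exact: classify_unique. Qed.

(** It preserves all joins, but not the meet \bot of the elements above
    \bot. *)
Definition omega_indicator (d : Order.disp_t) :
  frame_hom (omega_chain d) (sierpinski d).
Proof.
by apply: (@descending_hom d nat_levels d (sierpinski d) (fun=> \top)).
Defined.

Lemma frame_compE d (A B C : frameType d) (g : frame_hom B C) (f : frame_hom A B) x :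
  frame_comp g f x = g (f x).
Proof. by []. Qed.

(** * Self-equivalences of the category of frames *)

Section Equivalence.
Variables (d : Order.disp_t) (F : frameType d -> frameType d).
Variable Fm : forall A B : frameType d, frame_hom A B -> frame_hom (F A) (F B).
Hypothesis Fm_id : forall A, Fm (frame_id A) = frame_id (F A).
Hypothesis Fm_comp : forall A B C (g : frame_hom B C) (f : frame_hom A B),
  Fm (frame_comp g f) = frame_comp (Fm g) (Fm f).
Hypothesis Fm_full : forall A B (g : frame_hom (F A) (F B)), exists f, Fm f = g.
Hypothesis Fm_faithful : forall A B (f g : frame_hom A B), Fm f = Fm g -> f = g.

Local Notation S := (sierpinski d).
Local Notation mid := (mid d).
Local Notation "x ^^" := (classify d x) (at level 2, format "x ^^").

(** Conjugated by i, the endomorphisms of S that send mid to \bot and to \top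
    are the images of two distinct endomorphisms of S'.  The latter differ at
    some element x, and i composed with the image of [classify x] is a
    homomorphism F S -> S that still separates the former; these agree at \bot
    and \top, so its range contains mid. *)
Lemma exists_over_mid (S' : frameType d) (i : frame_hom (F S') S)
    (i' : frame_hom S (F S')) : cancel i i' -> cancel i' i ->
  exists (h : frame_hom (F S) S) (a : F S), h a = mid.
Proof.
move=> iK i'K.
pose g (s : S) := frame_comp i' (frame_comp s^^ i).
have [u0 Fu0] := Fm_full (g \bot); have [u1 Fu1] := Fm_full (g \top).
have [x ux] : exists x, u0 x <> u1 x.
  apply: contrapT => /forallNP u01.
  have : g \bot = g \top.
    by rewrite -Fu0 -Fu1; congr Fm; apply: frame_hom_eq => x; exact: contrapT.
  move=> /(congr1 (fun f : frame_hom _ _ => i (f (i' mid)))).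
  by rewrite !frame_compE !i'K.
exists (frame_comp i (Fm x^^)); apply: contrapT => /forallNP nomid.
apply: ux; have : frame_comp u0 x^^ = frame_comp u1 x^^.
  apply: Fm_faithful; rewrite !Fm_comp Fu0 Fu1; apply: frame_hom_eq => a.
  rewrite !frame_compE; congr (i' _).
  have := nomid a; rewrite frame_compE.
  by have [->|->|->] := sierpinskiE (i (Fm x^^ a)) => // /(_ erefl).
by move=> /(congr1 (fun f : frame_hom _ _ => f mid)).
Qed.

(** [classify a] is a section of h.  It is an isomorphism because the identity
    of F S is among the composites a^^ s^^ h: these are the images of
    endomorphisms of S that are pairwise distinct, hence exhaust all three. *)
Lemma sierpinski_fixed (h : frame_hom (F S) S) (a : F S) :
  h a = mid -> cancel a^^ h /\ cancel h a^^.
Proof.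
move=> ha; have aK : cancel a^^ h.
  move=> s; rewrite -frame_compE.
  by rewrite (_ : frame_comp h a^^ = frame_id S) //; apply: classify_unique.
split=> //.
have [k Fk] := choice (fun s => Fm_full (frame_comp a^^ (frame_comp s^^ h))).
have k_inj : injective (fun s => k s mid).
  move=> s s' /classify_unique ks; apply: (can_inj aK).
  have := Fk s; rewrite ks Fk => /(congr1 (fun f : frame_hom _ _ => f a)).
  by rewrite !frame_compE ha.
have [s ks] := sierpinski_inj_surj k_inj mid.
have ash : frame_comp a^^ (frame_comp s^^ h) = frame_id (F S).
  by rewrite -Fk -Fm_id; congr Fm; apply: classify_unique.
have sE : s = mid.
  apply: (can_inj aK).
  have := congr1 (fun f : frame_hom _ _ => f a) ash.
  by rewrite !frame_compE ha.
move=> z; have := congr1 (fun f : frame_hom _ _ => f z) ash.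
rewrite !frame_compE sE.
by rewrite (_ : mid^^ = frame_id S) //; apply: classify_unique.
Qed.

Section Transport.
Variables (h : frame_hom (F S) S) (a : F S).
Hypothesis ha : h a = mid.

Definition transport (A : frameType d) (x : A) : F A := Fm x^^ a.

Lemma transport_natural (A B : frameType d) (f : frame_hom A B) (x : A) :
  Fm f (transport x) = transport (f x).
Proof. by rewrite /transport -frame_compE -Fm_comp classify_natural. Qed.

(** Through the isomorphism of S with F S, the functor sends the classifying
    homomorphism of an element to that of its transport. *)
Lemma transport_hom (A : frameType d) (x : A) :
  Fm x^^ = frame_comp (transport x)^^ h.
Proof.
apply: frame_hom_eq => z; have [_ /(_ z) <-] := sierpinski_fixed ha.
rewrite !frame_compE (sierpinski_fixed ha).1 -!frame_compE classify_natural.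
by [].
Qed.

Lemma transport_inj (A : frameType d) : injective (@transport A).
Proof.
move=> x y xy.
have /Fm_faithful/(congr1 (fun f : frame_hom _ _ => f mid)) // : Fm x^^ = Fm y^^.
by rewrite !transport_hom xy.
Qed.

Lemma transport_surj (A : frameType d) (y : F A) : exists x : A, transport x = y.
Proof.
have [g Fg] := Fm_full (frame_comp y^^ h).
exists (g mid); rewrite -transport_natural Fg frame_compE.
have -> : transport mid = a.
  by rewrite /transport (_ : mid^^ = frame_id S) ?Fm_id //; apply: classify_unique.
by rewrite ha.
Qed.

(** One comparison in one frame decides for all frames, because the pair
    [lo <= hi] is universal and the transport natural. *)
Lemma transport_mono_or_anti :
  (forall A : frameType d, {homo @transport A : x y / x <= y}) \/
  (forall A : frameType d, {homo @transport A : x y /~ x <= y}).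
Proof.
have [w tw] := transport_surj (transport (lo d) `&` transport (hi d)).
have [e [elo ehi]] := chain4_hom d (lexx mid).
have ew : e w = mid.
  apply: transport_inj; rewrite -transport_natural tw frame_hom_meet.
  by rewrite !transport_natural elo ehi meetxx.
have {ew} : w = lo d \/ w = hi d.
  by case: (chain4E w) ew => ->; rewrite ?frame_hom_bot ?frame_hom_top //; auto.
case=> wE; rewrite {}wE in tw; [left | right] => A x y xy.
  have [c [<- <-]] := chain4_hom d xy.
  by rewrite -!transport_natural; apply: frame_hom_mono; rewrite tw leIr.
have [c [<- <-]] := chain4_hom d xy.
by rewrite -!transport_natural; apply: frame_hom_mono; rewrite tw leIl.
Qed.

(** With antitone transports, the join of the transports of the elements above
    \bot in the infinite chain is the transport of their meet \bot.  The
    image of [omega_indicator] preserves this join and maps all the joined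
    elements to the transport of \top, so \bot and \top would have the same
    transport in S. *)
Lemma transport_mono (A : frameType d) : {homo @transport A : x y / x <= y}.
Proof.
have [//|anti] := transport_mono_or_anti; exfalso.
pose Om := omega_chain d; pose t (n : nat) := transport (Some n : Om).
have [z tz] := transport_surj (bigjoin (range t)).
(* Otherwise z has an element strictly below it, whose transport is both below
   and above the transport of z. *)
have zb : z = \bot.
  case: z tz => // n tz.
  have : t n.+1 <= t n by rewrite [t n]tz; apply: (bigjoinP _).1; exists n.+1.
  have nS : (Some n.+1 : Om) <= Some n by rewrite /Order.le /=.
  move: (anti _ _ _ nS); rewrite -/(t n) -/(t n.+1) => le1 le2.
  have /transport_inj[] : t n = t n.+1 by apply: le_anti; rewrite le1 le2.
  by move/n_Sn.
have := congr1 (Fm (omega_indicator d)) tz.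
rewrite zb transport_natural frame_hom_bot frame_hom_join => e.
have : transport (\bot : S) = transport (\top : S).
  rewrite e; apply: bigjoin_max.
    by exists (t 0); [exists 0 | rewrite transport_natural].
  by move=> _ [_ [n _ <-] <-]; rewrite transport_natural.
by move=> /transport_inj.
Qed.

(** On the four-element chain C the monotone bijection [transport] is an order
    isomorphism, since C is total; composing its inverse with the homomorphism
    from C to F A that picks the transports of x and y gives a homomorphism
    from F C to F A, hence one from C to A by fullness. *)
Lemma transport_reflects (A : frameType d) (x y : A) :
  transport x <= transport y -> x <= y.
Proof.
move=> xy; pose C := chain4 d.
have [g tK gK] : exists2 g, cancel (@transport C) g & cancel g (@transport C).
  have [g gP] := choice (@transport_surj C).
  by exists g => // u; apply: transport_inj.
have t_le : {mono @transport C : u v / u <= v}.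
  move=> u v; apply/idP/idP; last exact: transport_mono.
  have [//|vu tuv] := orP (descending_le_total u v).
  suff -> : u = v by [].
  by apply: transport_inj; apply: le_anti; rewrite tuv transport_mono.
have g_le : {mono g : u v / u <= v} by move=> u v; rewrite -t_le !gK.
have [b [blo bhi]] := chain4_hom d xy.
have [c Fc] := Fm_full (frame_comp b (order_iso_hom tK g_le)).
have cE u : transport (c u) = b u.
  by rewrite -transport_natural Fc frame_compE /= tK.
have <- : c (lo d) = x by apply: transport_inj; rewrite cE.
have <- : c (hi d) = y by apply: transport_inj; rewrite cE.
exact: frame_hom_mono.
Qed.

Lemma transport_iso (A : frameType d) :
  exists (t : frame_hom A (F A)) (t' : frame_hom (F A) A),
    [/\ t =1 @transport A, cancel t t' & cancel t' t].
Proof.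
have [g gK] := choice (@transport_surj A).
have tK : cancel (@transport A) g by move=> x; apply: transport_inj.
have t_le : {mono @transport A : x y / x <= y}.
  by move=> x y; apply/idP/idP; [exact: transport_reflects | exact: transport_mono].
have g_le : {mono g : x y / x <= y} by move=> x y; rewrite -t_le !gK.
by exists (order_iso_hom gK t_le), (order_iso_hom tK g_le).
Qed.

End Transport.

Lemma frame_equivalence_iso (S' : frameType d) (i : frame_hom (F S') S)
    (i' : frame_hom S (F S')) : cancel i i' -> cancel i' i ->
  exists t : forall A, frame_hom A (F A),
    (forall A B (f : frame_hom A B),
      frame_comp (Fm f) (t A) = frame_comp (t B) f) /\
    (forall A, exists t' : frame_hom (F A) A, cancel (t A) t' /\ cancel t' (t A)).
Proof.
move=> iK i'K; have [h [a ha]] := exists_over_mid iK i'K.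
pose t A := projT1 (cid (transport_iso ha A)).
have tP A : t A =1 transport a (A := A) /\
    exists t' : frame_hom (F A) A, cancel (t A) t' /\ cancel t' (t A).
  by rewrite /t; case: cid => /= u [t' [tE tK t'K]]; split=> //; exists t'.
exists t; split=> [A B f|A]; last exact: (tP A).2.
apply: frame_hom_eq => x; rewrite !frame_compE (tP A).1 (tP B).1.
exact: transport_natural.
Qed.

End Equivalence.

(** * Full and faithful adjoints *)

(** Composition with the unit u at a is the composite of the bijections
    hom b a -> hom (L b) (L a) -> hom b (T (L a)), so u is invertible by the
    Yoneda argument. *)
Lemma left_adjoint_unit_iso (C : category) (L T : functor C C) (a : C) :
  left_adjoint L T -> full L -> faithful L ->
  exists u : hom a (T (L a)), is_iso u.
Proof.
move=> [phi [phi_bij phi_nat]] L_full L_faithful.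
pose u := phi a (L a) (idm (L a)).
have phiE b (f : hom b a) : phi b (L a) (fmap L f) = u \oc f.
  have := phi_nat a b (L a) (L a) f (idm _) (idm _).
  by rewrite !comp_idl fmap_id comp_idl.
have u_inj b : injective (fun f : hom b a => u \oc f).
  by move=> f g; rewrite -!phiE => /(bij_inj (phi_bij _ _)) /L_faithful.
have [psi psiK phiK] := phi_bij (T (L a)) (L a).
have [v Lv] := L_full _ _ (psi (idm _)).
have uv : u \oc v = idm _ by rewrite -phiE Lv phiK.
exists u, v; split=> //; apply: u_inj.
by rewrite comp_assoc uv comp_idl comp_idr.
Qed.

Theorem theorem9p4 (d : Order.disp_t) : rigid (Loc d).
Proof.
move=> T [T_full T_faithful [L [LT L_full L_faithful]]].
have [i [i' [i'i ii']]] :=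
  left_adjoint_unit_iso (sierpinski d : Loc d) LT L_full L_faithful.
pose Fm (A B : frameType d) (f : frame_hom A B) : frame_hom (T A) (T B) :=
  @fmap _ _ T B A f.
have Fm_id A : Fm A A (frame_id A) = frame_id (T A) by exact: (fmap_id T A).
have Fm_comp A B C (g : frame_hom B C) (f : frame_hom A B) :
    Fm A C (frame_comp g f) = frame_comp (Fm B C g) (Fm A B f).
  exact: (@fmap_comp _ _ T C B A f g).
have [||t [t_nat t_iso]] := @frame_equivalence_iso d T Fm Fm_id Fm_comp
  (fun A B => T_full B A) (fun A B => T_faithful B A) (L (sierpinski d)) i i'.
- by move=> x; exact: (congr1 (fun f : frame_hom _ _ => f x) ii').
- by move=> x; exact: (congr1 (fun f : frame_hom _ _ => f x) i'i).
exists t; split=> [A B f|A]; first exact: t_nat.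
by have [t' [tK t'K]] := t_iso A; exists t'; split; apply: frame_hom_eq.
Qed.
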